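(* Let $n\ge 1$ and $b\ge 2$ be integers, and let $w$ be a nonempty word over an $n$-letter alphabet. In the two-dimensional setting with $(b\times b)$-letter replacement rules, $$F_2^{hv}(b,n,w)\le \mathcal{W}_1(b,n,|w|).$$ That is, for each of the two directions (horizontal, vertical), every choice of $(b\times b)$-letter replacement rules and every starting level $L_1$, if $w$ appears in that direction on some level, then it appears in that direction on some level $L_k$ with $k\le \mathcal{W}_1(b,n,|w|)$.
   Context: Fix an alphabet with $n$ letters. A word is a nonempty finite string of letters; $|w|$ is the length of $w$. Two-dimensional setting: a replacement rule assigns to each letter $a$ a $b\times b$ array $R(a)$ of letters. For a rectangular array (grid) $G$ of letters, $R(G)$ is the array obtained by replacing each letter of $G$ by its $b\times b$ block, keeping the blocks in the same relative positions. The first level $L_1$ is any nonempty rectangular grid of letters and $L_{k+1}=R(L_k)$ for $k\ge 1$. A word appears horizontally on $L_k$ if it occurs on consecutive cells of a row read left to right, and vertically if it occurs on consecutive cells of a column read top to bottom. It appears for the first time in a given direction on $L_k$ if $k$ is the least index such that it appears in that direction on $L_k$. $F_2^{hv}(b,n,w)$ denotes the latest level on which $w$, as a horizontal or as a vertical word, can appear for the first time, i.e. the supremum, over the two directions and over all choices of replacement rules and all $L_1$ for which $w$ appears in that direction on at least one level, of the index of the level on which $w$ appears for the first time in that direction. The function $\mathcal{W}_1$ is defined by $$\mathcal{W}_1(b,n,|w|)=\begin{cases} n & |w|=1,\\ \lceil \log_b(b|w|-b)\rceil+n^2 & |w|>1.\end{cases}$$ *)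

(* Defs.v *)
From mathcomp Require Import all_boot all_order all_algebra.
From mathcomp Require Import all_classical all_reals all_analysis.

Set Implicit Arguments.
Unset Strict Implicit.
Unset Printing Implicit Defensive.

Import Order.TTheory GRing.Theory Num.Theory.
Local Open Scope ring_scope.

Record grid (A : Type) := Grid {
  height : nat;
  width : nat;
  cells :> 'M[A]_(height, width) }.

Definition nonempty_grid (A : Type) (G : grid A) : bool :=
  (0 < height G)%N && (0 < width G)%N.

Definition rules (A : Type) (b : nat) := A -> 'M[A]_b.

Definition replace (A : Type) (b : nat) (r : rules A b) (G : grid A) : grid A :=
  Grid (\mxblock_(i < height G, j < width G) r (G i j)).

(* Levels are numbered from 1: only [level r L1 k] with [0 < k] is meaningful. *)
Definition level (A : Type) (b : nat) (r : rules A b) (L1 : grid A) (k : nat) :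
  grid A := iter k.-1 (replace r) L1.

Inductive direction := Horizontal | Vertical.

(* [infix w s]: [w] occurs as a block of consecutive entries of [s]. *)
Definition appears (A : eqType) (d : direction) (w : seq A) (G : grid A) : bool :=
  match d with
  | Horizontal =>
      [exists i : 'I_(height G), infix w [seq G i j | j : 'I_(width G)]]
  | Vertical =>
      [exists j : 'I_(width G), infix w [seq G i j | i : 'I_(height G)]]
  end.

Definition first_appears (A : eqType) (b : nat) (d : direction) (w : seq A)
    (r : rules A b) (L1 : grid A) (k : nat) : Prop :=
  [/\ (0 < k)%N, appears d w (level r L1 k)
    & forall j : nat, (0 < j < k)%N -> ~~ appears d w (level r L1 j)].

(* The supremum is taken in the extended reals, so that it is [+oo] when the
   levels of first appearance are unbounded. *)
Definition F2hv (R : realType) (A : finType) (b : nat) (w : seq A) : \bar R :=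
  ereal_sup [set (k%:R)%:E | k in
    [set k : nat | exists (d : direction) (r : rules A b) (L1 : grid A),
       nonempty_grid L1 /\ first_appears d w r L1 k]]%classic.

Definition log_base (R : realType) (b x : R) : R := ln x / ln b.

Definition W1 (R : realType) (b n l : nat) : int :=
  if l == 1%N then n%:Z
  else Num.ceil (log_base (b%:R : R) (b%:R * l%:R - b%:R)) + (n ^ 2)%N%:Z.

(* Main.v *)
Require Import Defs.
From mathcomp Require Import all_boot all_order all_algebra.
From mathcomp Require Import all_classical all_reals all_analysis.
From mathcomp Require Import zify.

(** Transposing grids and rules turns vertical words into horizontal ones, so
    only rows matter.  The cell [(i, j)] of the grid obtained after [s]
    replacements is determined by the letter at [(i %/ b ^ s, j %/ b ^ s)] of
    the original grid together with the two remainders.  Hence an occurrence of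
    a word [w] after [s] replacements only depends on the window of [m]
    consecutive letters below which it lies, provided
    [size w <= (m - 1) * b ^ s + 1]: wherever that window reappears, [w]
    reappears [s] levels later ([window_factor]).

    Used with [s = 1], this bounds the first level of words of a fixed length
    [m] ([short_word_early]).  If such a word is new on a level, then the window
    above it is new on the previous level, so walking upwards yields a different
    word of length [m] on each level, as long as rows are wide enough to contain
    a window.  There are [n ^ m] words in total.  For [m = 1] the walk reaches
    the first level; for [m = 2] it reaches the second one, whose rows have at
    least [b >= 2] cells.  So letters are first seen by level [n] and pairs by
    level [n ^ 2 + 1].

    Finally, a word of length [l > 1] lies below a pair [s] levels higher as
    soon as [l - 1 <= b ^ s], whence the bound [s + 1 + n ^ 2].  The least such
    [s] satisfies [s + 1 = ceil (log_b (b * l - b))]. *)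

Set Implicit Arguments.
Unset Strict Implicit.
Unset Printing Implicit Defensive.
Local Open Scope nat_scope.

(** * Cells of iterated replacements *)

(** Indexing by plain numbers, with [None] outside the grid, lets quotients and
    remainders be used as coordinates without bound proofs. *)
Definition cell (A : Type) (G : grid A) (i j : nat) : option A :=
  obind (fun i' => omap (fun j' => G i' j') (insub j)) (insub i).

Lemma cell_ord (A : Type) (G : grid A) (i : 'I_(height G)) (j : 'I_(width G)) :
  cell G i j = Some (G i j).
Proof. by rewrite /cell !valK. Qed.

Lemma cell_isSome (A : Type) (G : grid A) i j :
  cell G i j = (i < height G) && (j < width G) :> bool.
Proof.
by rewrite /cell; case: insubP => [? -> _|/negbTE->] //=;
   case: insubP => [? -> _|/negbTE->].
Qed.

Lemma equal_blocksE n b (s : 'I_(\sum_(k < n) b)) :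
  (tagnat.sig1 s = s %/ b :> nat) * (tagnat.sig2 s = s %% b :> nat).
Proof.
have := congr1 (@nat_of_ord _) (tagnat.sig2K s); rewrite tagnat.RankEsum.
set p := tagnat.sig2 s; set i := tagnat.sig1 s.
rewrite sum_nat_const (_ : #|_| = i); last first.
  rewrite -sum1_card (eq_bigl (fun k : 'I_n => k < i)) //.
  rewrite -(big_ord_widen n (fun=> 1)); last exact: ltnW.
  by rewrite sum1_card card_ord.
have pb : p < b := ltn_ord p.
have b0 : 0 < b by apply: leq_trans pb.
by move=> <-; rewrite divnMDl // modnMDl divn_small // modn_small // addn0.
Qed.

Lemma cell_replace (A : Type) b (r : rules A b) (G : grid A) i j : 0 < b ->
  cell (replace r G) i j =
  obind (fun a => cell (Grid (r a)) (i %% b) (j %% b))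
        (cell G (i %/ b) (j %/ b)).
Proof.
move=> b0.
have hE : height (replace r G) = height G * b.
  by rewrite /= sum_nat_const card_ord.
have wE : width (replace r G) = width G * b.
  by rewrite /= sum_nat_const card_ord.
have [/andP[hi wj]|out] :=
  boolP ((i < height (replace r G)) && (j < width (replace r G))).
  rewrite -[i in LHS]/(val (Ordinal hi)) -[j in LHS]/(val (Ordinal wj)).
  rewrite cell_ord mxE; set x := Ordinal hi; set y := Ordinal wj.
  rewrite -[i %/ b](equal_blocksE x).1 -[j %/ b](equal_blocksE y).1.
  rewrite -[i %% b](equal_blocksE x).2 -[j %% b](equal_blocksE y).2.
  by rewrite cell_ord /= (@cell_ord _ (Grid _)).
have -> : cell (replace r G) i j = None.
  by have := cell_isSome (replace r G) i j; rewrite (negbTE out); case: cell.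
have := cell_isSome G (i %/ b) (j %/ b).
by rewrite !ltn_divLR // -hE -wE (negbTE out); case: (cell G _ _).
Qed.

Lemma width_iter_replace (A : Type) b (r : rules A b) (G : grid A) s :
  width (iter s (replace r) G) = width G * b ^ s.
Proof.
elim: s => [|s IHs]; first by rewrite muln1.
by rewrite iterS /= sum_nat_const card_ord IHs expnSr mulnA.
Qed.

(** [E a] is the [b ^ s] by [b ^ s] array that a letter [a] becomes after [s]
    replacements; what matters is that it does not depend on the grid. *)
Lemma cell_iter_replace (A : Type) b (r : rules A b) s : 0 < b ->
  exists E : A -> nat -> nat -> option A, forall (G : grid A) i j,
  cell (iter s (replace r) G) i j =
  obind (fun a => E a (i %% b ^ s) (j %% b ^ s))
        (cell G (i %/ b ^ s) (j %/ b ^ s)).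
Proof.
move=> b0; elim: s => [|s [E IHs]].
  exists (fun a _ _ => Some a) => G i j.
  by rewrite expn0 !divn1 /=; case: cell.
exists (fun a p q => obind (fun c => cell (Grid (r c)) (p %% b) (q %% b))
                           (E a (p %/ b) (q %/ b))).
move=> G i j; rewrite iterS cell_replace // IHs expnS.
rewrite -!divnMA mulnC !modn_divl mulnC.
have modE m : m %% (b * b ^ s) %% b = m %% b.
  by rewrite modn_dvdm // dvdn_mulr.
by rewrite !modE; case: (cell G _ _).
Qed.

(** * Occurrences of words in rows *)

Definition occurs (A : Type) (w : seq A) (G : grid A) i j :=
  forall t, t < size w -> cell G i (j + t) = onth w t.

Lemma occurs_width (A : Type) (w : seq A) G i j :
  occurs w G i j -> 0 < size w -> j + size w <= width G.
Proof.
move=> wG w0; have lt : (size w).-1 < size w by rewrite prednK.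
have := cell_isSome G i (j + (size w).-1).
by rewrite wG // onthTE lt => /esym/andP[_]; rewrite -addnS prednK.
Qed.

Lemma infix_onthP (A : eqType) (w s : seq A) :
  reflect (exists j, forall t, t < size w -> onth s (j + t) = onth w t)
          (infix w s).
Proof.
apply: (iffP (@infixP A _ _)) => [[s1 [s2 ->]]|[j sw]].
  exists (size s1) => t tw; rewrite !onthE !map_cat !nth_cat !size_map.
  by rewrite ltnNge leq_addr addKn tw.
have -> : w = take (size w) (drop j s).
  apply: eq_from_onth => t; have [tw|wt] := ltnP t (size w).
    by rewrite -sw // !onthE map_take map_drop nth_take // nth_drop.
  rewrite !onth_default // size_take_min.
  by apply: leq_trans wt; apply: geq_minl.
by exists (take j s), (drop (size w) (drop j s)); rewrite !cat_take_drop.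
Qed.

Lemma onth_row (A : Type) (G : grid A) (i : 'I_(height G)) j :
  onth [seq G i k | k : 'I_(width G)] j = cell G i j.
Proof.
have [lt|ge] := ltnP j (width G).
  rewrite -[j in RHS]/(nat_of_ord (Ordinal lt)) cell_ord onthE -map_comp.
  rewrite (nth_map (Ordinal lt)) ?size_enum_ord //=.
  by congr (Some (G i _)); apply: val_inj; rewrite /= nth_enum_ord.
rewrite onth_default ?size_image ?card_ord //.
by have := cell_isSome G i j; rewrite [j < _]ltnNge ge andbF; case: cell.
Qed.

Lemma appears_occurs (A : eqType) (w : seq A) (G : grid A) : 0 < size w ->
  appears Horizontal w G <-> exists i j, occurs w G i j.
Proof.
move=> w0; split=> [/existsP[i /infix_onthP[j wj]]|[i [j wG]]].
  by exists i, j => t tw; rewrite -onth_row wj.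
have hi : i < height G.
  by have := cell_isSome G i (j + 0); rewrite wG // onthTE w0 => /esym/andP[].
apply/existsP; exists (Ordinal hi); apply/infix_onthP; exists j => t tw.
by rewrite onth_row wG.
Qed.

(** * The window above an occurrence *)

(** An interval of at most [(m - 1) * b ^ s + 1] cells meets at most [m]
    consecutive blocks of width [b ^ s].  When it meets fewer, the window [u] is
    completed to length [m] with neighbouring letters, which is why the rows of
    [G] need [m] cells. *)
Lemma window_factor (A : eqType) b (r : rules A b) (w : seq A) (s m : nat)
    (G : grid A) :
  0 < b -> 0 < size w -> 0 < m -> size w <= (m - 1) * b ^ s + 1 ->
  m <= width G -> appears Horizontal w (iter s (replace r) G) ->
  exists u : m.-tuple A, appears Horizontal u G /\
    forall H : grid A, appears Horizontal u H ->
      appears Horizontal w (iter s (replace r) H).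
Proof.
move=> b0 w0 m0 wm mG /appears_occurs -/(_ w0) [i [j wij]].
have [E cellE] := cell_iter_replace r s b0.
set B := b ^ s in wm cellE.
have B0 : 0 < B by rewrite expn_gt0 b0.
have jw : j + size w <= width G * B.
  by rewrite -(width_iter_replace r); apply: occurs_width wij w0.
have hi : i %/ B < height G.
  have : isSome (cell (iter s (replace r) G) i (j + 0)).
    by rewrite wij // onthTE.
  rewrite cellE; have := cell_isSome G (i %/ B) ((j + 0) %/ B).
  by case: (cell G _ _) => // a /esym/andP[].
(* The window starts at the block of [j], or further left when that would
   overrun the right border of [G]. *)
have [K [KG jK wK]] : exists K,
    [/\ K + m <= width G, K * B <= j & j + size w <= (K + m) * B].
  have [jle|jgt] := leqP (j %/ B + m) (width G).
    exists (j %/ B); split; rewrite ?leq_trunc_div //.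
    have lt := ltn_pmod j B0.
    rewrite {1}(divn_eq j B) mulnDl -addnA leq_add2l.
    have -> : m * B = (m - 1) * B + B by rewrite -mulSnr subn1 prednK.
    lia.
  exists (width G - m); split; rewrite ?subnK //.
  apply: leq_trans (leq_trunc_div j B).
  by rewrite leq_mul2r; apply/orP; right; lia.
set row := [seq G (Ordinal hi) k | k : 'I_(width G)].
have szu : size (take m (drop K row)) == m.
  by rewrite size_takel // size_drop size_image card_ord; lia.
have uE t : t < m -> onth (Tuple szu) t = cell G (i %/ B) (K + t).
  move=> tm; rewrite -[i %/ B]/(nat_of_ord (Ordinal hi)) -onth_row.
  by rewrite /= !onthE map_take map_drop nth_take // nth_drop.
have u0 : 0 < size (Tuple szu) by rewrite size_tuple.
exists (Tuple szu); split=> [|H /appears_occurs -/(_ u0) [I [J uIJ]]].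
  apply/appears_occurs => //; exists (i %/ B), K => t.
  by rewrite size_tuple => /uE.
(* The copy of [w] keeps its offset relative to the window. *)
apply/appears_occurs => //.
exists (I * B + i %% B), (J * B + (j - K * B)) => t tw.
rewrite -wij // !cellE.
have -> : j + t = K * B + (j - K * B + t) by lia.
rewrite -addnA !divnMDl // !modnMDl (divn_small (ltn_pmod i B0)) modn_mod addn0.
have tm : (j - K * B + t) %/ B < m by rewrite ltn_divLR //; lia.
by rewrite uIJ ?size_tuple // uE.
Qed.

(** * Short words appear early *)

(** If [y] first holds at [k.+1], its parent first holds at [k], since an earlier
    occurrence of the parent would produce an earlier one of [y].  Descending to
    [t0] gives one element for each index between [t0] and [k]; they are distinct
    because their first indices are. *)
Lemma first_index_lt_card (T : finType) (P : nat -> pred T) t0 :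
  (forall t y, t0 <= t -> P t.+1 y ->
    exists2 x, P t x & forall t', P t' x -> P t'.+1 y) ->
  forall k y, P k y -> exists2 k', k' < t0 + #|T| & P k' y.
Proof.
move=> parent k y Pky.
pose first x t := P t x /\ forall t', P t' x -> t <= t'.
have [k0 Pk0 k0_min] := ex_minnP (ex_intro (fun t => P t y) k Pky).
exists k0 => //; rewrite ltnNge; apply/negP => k0_ge.
have chain d : t0 + d <= k0 -> exists x, first x (k0 - d).
  elim: d => [|d IHd] le_k0; first by exists y; rewrite subn0.
  have [|x [Px x_min]] := IHd; first by lia.
  have eS : k0 - d = (k0 - d.+1).+1 by lia.
  rewrite eS in Px x_min.
  have [|z Pz zx] := parent _ _ _ Px; first by lia.
  by exists z; split=> // t' /zx /x_min.
have t0_k0 (d : 'I_#|T|.+1) : t0 + d <= k0.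
  by apply: leq_trans k0_ge; rewrite leq_add2l -ltnS.
have le_k0 (d : 'I_#|T|.+1) : d <= k0.
  exact: leq_trans (leq_addl _ _) (t0_k0 d).
have : forall d : 'I_#|T|.+1, exists x, first x (k0 - d).
  by move=> d; apply: chain.
case/fin_all_exists => f fP.
have inj_f : injective f.
  move=> d e fde; apply: val_inj.
  have [[Pd d_min] [Pe e_min]] := (fP d, fP e).
  rewrite -fde in Pe e_min.
  have eq_de : k0 - d = k0 - e by apply: anti_leq; rewrite d_min // e_min.
  by rewrite /= -(subKn (le_k0 d)) eq_de subKn.
by have := leq_card f inj_f; rewrite card_ord ltnn.
Qed.

(** For words of length [m], one replacement satisfies the length condition of
    [window_factor], as [m <= (m - 1) * b + 1].  So every word of length [m] has
    a parent of the same length one level higher, once rows are wide enough,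
    which [t0] guarantees from then on. *)
Lemma short_word_early (A : finType) b (r : rules A b) (G : grid A)
    (w : seq A) t0 k :
  0 < b -> 0 < size w -> size w <= width (iter t0 (replace r) G) ->
  appears Horizontal w (iter k (replace r) G) ->
  exists2 k', k' < t0 + #|A| ^ size w &
    appears Horizontal w (iter k' (replace r) G).
Proof.
move=> b0 w0 w_t0 w_k.
pose P t (x : (size w).-tuple A) := appears Horizontal x (iter t (replace r) G).
rewrite -card_tuple; apply: (@first_index_lt_card _ P t0 _ k (in_tuple w)) => //.
move=> t y t0t Py.
have y0 : 0 < size y by rewrite size_tuple.
have y_size : size y <= (size w - 1) * b ^ 1 + 1.
  by rewrite size_tuple expn1; nia.
have w_t : size w <= width (iter t (replace r) G).
  apply: leq_trans w_t0 _; rewrite !width_iter_replace leq_mul2l.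
  by rewrite leq_pexp2l // orbT.
have [u [Pu uy]] := @window_factor A b r y 1 _ _ b0 y0 w0 y_size w_t Py.
by exists u => // t' /uy.
Qed.

(** For [k > s] the pair above [w] lies on a grid obtained by at least one
    replacement, whose rows have two cells even if [G] has a single column.  This
    is why [short_word_early] is used from index [1] on. *)
Lemma long_word_early (A : finType) b (r : rules A b) (G : grid A)
    (w : seq A) s k :
  1 < b -> 0 < width G -> 0 < size w <= b ^ s + 1 ->
  appears Horizontal w (iter k (replace r) G) ->
  exists2 k', k' <= s + #|A| ^ 2 & appears Horizontal w (iter k' (replace r) G).
Proof.
move=> b1 G0 /andP[w0 ws] w_k; have b0 := ltnW b1.
have [k_s|s_k] := leqP k s; first by exists k => //; lia.
have wide t : 0 < t -> 2 <= width (iter t (replace r) G).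
  case: t => // t _; rewrite width_iter_replace expnS.
  by have : 0 < b ^ t; [rewrite expn_gt0 b0 | nia].
have kE : k = s + (k - s) by rewrite subnKC // ltnW.
rewrite kE iterD in w_k.
have ws' : size w <= (2 - 1) * b ^ s + 1 by rewrite mul1n.
have k_s_wide : 2 <= width (iter (k - s) (replace r) G).
  by apply: wide; rewrite subn_gt0.
have [u [u_ks uw]] := @window_factor A b r w s 2 _ b0 w0 isT ws' k_s_wide w_k.
have u0 : 0 < size u by rewrite size_tuple.
have u_wide : size u <= width (iter 1 (replace r) G) by rewrite size_tuple wide.
have [k' lt_k' u_k'] := @short_word_early A b r G u 1 _ b0 u0 u_wide u_ks.
exists (s + k'); last by rewrite iterD; apply: uw.
by move: lt_k'; rewrite size_tuple; lia.
Qed.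

(** * Reduction to the horizontal direction *)

Definition tr_grid (A : Type) (G : grid A) : grid A := Grid (cells G)^T%R.

Lemma tr_replace (A : Type) b (r : rules A b) (G : grid A) :
  tr_grid (replace r G) = replace (fun a => (r a)^T%R) (tr_grid G).
Proof.
rewrite /replace /tr_grid /= tr_mxblock; congr Grid.
by apply/matrixP => i j; rewrite !mxE.
Qed.

Lemma appears_tr (A : eqType) (w : seq A) (G : grid A) :
  appears Vertical w G = appears Horizontal w (tr_grid G).
Proof.
apply: eq_existsb => j; congr infix.
by apply: eq_map => i; rewrite mxE.
Qed.

Lemma appears_horizontally (A : eqType) (d : direction) (w : seq A) b
    (r : rules A b) (G : grid A) : nonempty_grid G ->
  exists (r' : rules A b) (G' : grid A), 0 < width G' /\ forall k,
    appears d w (iter k (replace r) G) =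
    appears Horizontal w (iter k (replace r') G').
Proof.
case/andP=> h0 w0; case: d; first by exists r, G.
exists (fun a => (r a)^T%R), (tr_grid G); split=> // k.
rewrite appears_tr; congr (appears _ _ _).
by elim: k => //= k IHk; rewrite tr_replace IHk.
Qed.

(** * The bound *)

Import Order.TTheory GRing.Theory Num.Theory.

(** The factor [b] in the logarithm accounts for the first level, which has
    index one: [log_b (b * (l - 1)) = 1 + log_b (l - 1)]. *)
Lemma ceil_log_block (R : realType) (b l : nat) : 1 < b -> 1 < l ->
  exists2 s : nat, l <= b ^ s + 1 &
    Num.ceil (log_base (b%:R : R) (b%:R * l%:R - b%:R)%R) = s.+1%:Z%R.
Proof.
move=> b1 l1.
have -> : (b%:R * l%:R - b%:R = (b * (l - 1))%N%:R :> R)%R.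
  by rewrite natrM natrB ?mulrBr ?mulr1 // ltnW.
set x : R := ((_ * _)%N%:R)%R; set c := Num.ceil _.
have b_gt1 : (1 < b%:R :> R)%R by rewrite ltr1n.
have lnb : (0 < ln (b%:R : R))%R by apply: ln_gt0.
have bx : (b%:R <= x)%R by rewrite ler_nat; nia.
have x_gt1 : (1 < x)%R by apply: lt_le_trans bx.
have c0 : (0 < c)%R by rewrite ceil_gt0 divr_gt0 // ln_gt0.
have [s cE] : exists s : nat, c = s.+1%:Z%R.
  by case: (c) c0 => [[|s]|] // _; exists s.
exists s => //.
have := ceil_ge (log_base (b%:R : R) x); rewrite -/c cE.
have b_pos : (0 < b%:R :> R)%R by apply: lt_trans b_gt1.
rewrite /log_base ler_pdivrMr // -pmulrn mulr_natl -lnXn //.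
rewrite ler_ln ?posrE ?exprn_gt0 //; last by apply: lt_trans x_gt1.
rewrite -natrX ler_nat expnS leq_pmul2l; lia.
Qed.

Local Open Scope ring_scope.

Theorem theorem7 (R : realType) (n b : nat) (A : finType) (w : seq A) :
  (1 <= n)%N -> (2 <= b)%N -> #|A| = n -> w <> [::] ->
  (F2hv R b w <= ((W1 R b n (size w))%:~R)%:E)%E.
Proof.
move=> n1 b2 cardA wN.
have w0 : (0 < size w)%N by case: w wN.
apply: ge_ereal_sup => _ [k [d [r [L1 [L1N [k0 wk first_k]]]]] <-].
have [r' [G [G0 trE]]] := appears_horizontally d w r L1N.
have {}first_k k' :
    appears Horizontal w (iter k' (replace r') G) -> (k <= k'.+1)%N.
  rewrite -trE => wk'; rewrite leqNgt; apply/negP => lt_k.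
  by have /negP := first_k k'.+1 lt_k; apply.
move: wk; rewrite /level trE => wk.
rewrite lee_fin pmulrn ler_int /W1.
case: eqP => [w1|/eqP w_neq1].
  have [|k' lt_k' wk'] := @short_word_early A b r' G w 0 k.-1 (ltnW b2) w0 _ wk.
    by rewrite w1.
  move: lt_k'; rewrite w1 expn1 cardA add0n => lt_k'.
  by rewrite lez_nat; apply: leq_trans (first_k _ wk') lt_k'.
have w2 : (1 < size w)%N by case: (size w) w0 w_neq1 => [|[]].
have [s ws ->] := ceil_log_block R b2 w2.
have [|k' le_k' wk'] := @long_word_early A b r' G w s k.-1 b2 G0 _ wk.
  by rewrite w0.
rewrite -PoszD lez_nat; apply: leq_trans (first_k _ wk') _.
by rewrite -cardA addSn ltnS.
Qed.
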